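(* Let $n>1$ and $e\ge n-1$ be integers and let $p$ be a prime. Let $$b(n,e) = \max_{0 \leq d \leq n-1} \left\lfloor\frac{e}{n-1+d}\right\rfloor \cdot d\,(n-1-d),$$ where the maximum is over all integers $d$ with $0\le d\le n-1$. Then $$f_n(p^e)\geq p^{b(n,e)}.$$
   Context: A subring of $\mathbb{Z}^n$ is a sublattice (additive subgroup) of $\mathbb{Z}^n$ that contains the multiplicative identity $(1,1,\ldots,1)$ and is closed under componentwise multiplication. For a positive integer $m$, $f_n(m)$ denotes the number of subrings of $\mathbb{Z}^n$ of finite index $m$. *)

(* Defs.v *)
From mathcomp Require Import all_boot all_order all_algebra finmap.
From mathcomp Require Import boolp classical_sets cardinality.

Set Implicit Arguments.
Unset Strict Implicit.
Unset Printing Implicit Defensive.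

Import GRing.Theory.

Local Open Scope classical_set_scope.
Local Open Scope ring_scope.

(* The ring structure of {ffun 'I_n -> int} is componentwise, so its 1 is the
   all-ones vector. Closure under subtraction and 1 \in L make L an additive
   subgroup. *)
Definition is_subring (n : nat) (L : set {ffun 'I_n -> int}) : Prop :=
  GRing.subring_closed (mem L).

Definition cosets (V : zmodType) (L : set V) : set (set V) :=
  [set [set x + y | y in L] | x in [set: V]].

(* Index m forces the index to be finite. *)
Definition has_index (V : zmodType) (L : set V) (m : nat) : Prop :=
  (cosets L #= `I_m)%card.

(* The cardinality is that of the finite set underlying the collection, and
   would be 0 if the collection were infinite; for m > 0 it never is, since a
   sublattice of index m contains m Z^n. *)
Definition num_subrings (n m : nat) : nat :=
  #|` fset_set [set L : set {ffun 'I_n -> int} |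
                  is_subring L /\ has_index L m] |%fset.

Local Close Scope ring_scope.

Definition bexp (n e : nat) : nat :=
  \max_(d < n) e %/ (n.-1 + d) * (d * (n.-1 - d)).

(* Main.v *)
(* Fix a coordinate o and split the others into X, with |X| = d, and Y.  For
   a d x (n-1-d) matrix a with entries modulo p^k, consider the vectors whose
   differences u_i = v_i - v_o satisfy u_j = p^(a_j) z_j for j in Y and
   u_i = p^k \sum_(j in Y) a_ij z_j modulo p^(2k) for i in X.  Once a_j >= k
   this lattice is closed under products, because every u lies in p^k Z^n and
   the products z_j z'_j appear multiplied by p^k p^(a_j).  Its index is
   p^(2kd + \sum_j a_j), and it determines a.  If Y is nonempty the a_j can
   absorb whatever is left of e, so k = e %/ (n-1+d) yields p^(k d (n-1-d))
   subrings of index exactly p^e. *)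
Require Import Defs.
From mathcomp Require Import all_boot all_order all_algebra finmap.
From mathcomp Require Import boolp classical_sets cardinality.
From mathcomp Require Import zify ring.

Set Implicit Arguments.
Unset Strict Implicit.
Unset Printing Implicit Defensive.

Import Order.TTheory GRing.Theory Num.Theory.

Local Open Scope classical_set_scope.
Local Open Scope ring_scope.

(** * Index as a number of fibers *)

Lemma has_index_fibers (V : zmodType) (L : set V) (T : finType) (F : V -> T) :
  (forall x y, F x = F y <-> L (y - x)) -> (forall t, exists x, F x = t) ->
  has_index L #|T|.
Proof.
move=> FL Fsurj.
pose g (i : 'I_#|T|) : set V := F @^-1` [set enum_val i].
have -> : has_index L #|T| = (g @` [set: 'I_#|T|] #= `I_#|T|)%card.
  congr (_ #= _)%card.
  (* Each coset is the fiber of [F] through its representative. *)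
  have cosetE x : [set x + y | y in L] = F @^-1` [set F x].
    apply/seteqP; split=> z /=.
      by case=> y Ly <-; apply/esym/FL; rewrite addrC addKr.
    by move=> /esym /FL Lzx; exists (z - x) => //; rewrite addrC subrK.
  apply/seteqP; split=> C /=.
    case=> x _ <-; exists (enum_rank (F x)) => //.
    by rewrite /g enum_rankK cosetE.
  case=> i _ <-; have [x Fx] := Fsurj (enum_val i).
  by exists x => //; rewrite cosetE Fx.
apply: card_eq_trans (inj_card_eq _) _.
  move=> i j _ _ /seteqP[gij _]; apply: enum_val_inj.
  have [x Fx] := Fsurj (enum_val i).
  by rewrite -Fx; exact: (gij x).
by rewrite card_eq_sym; exact: card_II.
Qed.

(** * Finiteness of the set of subrings of given index *)

Section Finiteness.
Variable n : nat.
Implicit Types (L : set {ffun 'I_n -> int}) (v : {ffun 'I_n -> int}).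

Lemma subring0 L : is_subring L -> L 0.
Proof.
by case=> L1 LB _; have := LB _ _ L1 L1; rewrite subrr => /set_mem.
Qed.

Lemma subringB L v w : is_subring L -> L v -> L w -> L (v - w).
Proof.
by case=> _ LB _ Lv Lw; apply/set_mem/LB; apply/mem_set.
Qed.

Lemma subringD L v w : is_subring L -> L v -> L w -> L (v + w).
Proof.
move=> HL Lv Lw; rewrite -[w]opprK; apply: subringB => //.
by rewrite -sub0r; apply: subringB => //; exact: subring0.
Qed.

Lemma subringMn L v k : is_subring L -> L v -> L (v *+ k).
Proof.
move=> HL Lv; elim: k => [|k IHk]; first by rewrite mulr0n; exact: subring0.
by rewrite mulrS; exact: subringD.
Qed.

(* Two of the m + 1 multiples of v indexed by 0, ..., m lie in the same coset. *)
Lemma index_fact_mul L m v :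
  is_subring L -> has_index L m -> L (v *+ m`!).
Proof.
move=> HL /card_set_bijP[f [fm finj _]].
pose C (k : nat) := [set v *+ k + y | y in L].
have cosC k : cosets L (C k) by exists (v *+ k).
pose h (i : 'I_m.+1) : 'I_m := Ordinal (fm _ (cosC i)).
have [/injectiveP/leq_card|/injectivePn[x [y nxy]]] := boolP (injectiveb h).
  by rewrite !card_ord ltnn.
move=> /(congr1 val) /= /finj; rewrite !inE => /(_ (cosC _) (cosC _)) Cxy.
wlog ltxy : x y nxy Cxy / (x < y)%N.
  move=> W; have [/W|/W|/val_inj exy] := ltngtP x y; first exact.
    by apply=> //; rewrite eq_sym.
  by rewrite exy eqxx in nxy.
have : C y (v *+ y) by exists 0; [exact: subring0 | rewrite addr0].
rewrite -Cxy => -[z Lz vz].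
have Lyx : L (v *+ (y - x)).
  by rewrite mulrnBr ?(ltnW ltxy) // -vz addrC addKr.
have /dvdnP[q ->] : (y - x %| m`!)%N.
  by apply: dvdn_fact; have := ltn_ord y; lia.
by rewrite mulnC mulrnA; exact: subringMn.
Qed.

(** Such a subring contains m! Z^n, so it is determined by [res L], its set of residue vectors
    modulo m!, and there are finitely many such sets. *)
Lemma finite_subrings m :
  finite_set [set L : set {ffun 'I_n -> int} | is_subring L /\ has_index L m].
Proof.
have [M eM] : exists M, m`! = M.+1 by exists m`!.-1; rewrite prednK ?fact_gt0.
pose res L := [set r : {ffun 'I_n -> 'I_M.+1} |
  `[< L [ffun i => (val (r i))%:Z] >] ]%SET.
have resP L v : is_subring L -> has_index L m ->
    L v <-> [ffun i => inord `|(v i %% M.+1)%Z|%N] \in res L.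
  move=> HL Lm; rewrite inE asboolE.
  set w := (X in _ <-> L X).
  (* Division with remainder in each coordinate: [w] is the reduced representative of [v] modulo
     m!. *)
  have -> : v = w + [ffun i => (v i %/ M.+1)%Z] *+ m`!.
    apply/ffunP => i; rewrite ffunE ffunMnE !ffunE /= inordK; last first.
      rewrite -ltz_nat gez0_abs ?modz_ge0 //.
      exact: ltz_pmod.
    rewrite gez0_abs ?modz_ge0 // eM [LHS](divz_eq _ M.+1) addrC.
    by rewrite -mulr_natr natz.
  have Lq := index_fact_mul [ffun i => (v i %/ M.+1)%Z] HL Lm.
  split=> [Lv|Lw]; last exact: subringD.
  by rewrite -[w](addrK ([ffun i => (v i %/ M.+1)%Z] *+ m`!)); exact: subringB.
set S := (X in finite_set X).
have res_inj : {in S &, injective res}.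
  move=> L1 L2 /set_mem[HL1 Lm1] /set_mem[HL2 Lm2] e12.
  apply/seteqP; split=> v.
    by move=> /(resP _ _ HL1 Lm1); rewrite e12 => /(resP _ _ HL2 Lm2).
  by move=> /(resP _ _ HL2 Lm2); rewrite -e12 => /(resP _ _ HL1 Lm1).
by rewrite -(eq_finite_set (inj_card_eq res_inj)); exact: finite_finset.
Qed.

(** Finiteness ensures that [fset_set] is the whole collection and not its default value, the empty
    set. *)
Lemma num_subrings_ge m (T : finType) (D : {pred T})
    (F : T -> set {ffun 'I_n -> int}) :
  (forall t, t \in D -> is_subring (F t)) ->
  (forall t, t \in D -> has_index (F t) m) ->
  {in D &, injective F} -> (#|D| <= num_subrings n m)%N.
Proof.
move=> HF Fm Finj; rewrite /num_subrings.
apply: (@leq_trans #|` [fset F t | t in D] |%fset).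
  by rewrite card_in_imfset //= -cardE.
apply: fsubset_leq_card; apply/fsubsetP => L /imfsetP[t /= tD ->].
rewrite in_fset_set ?inE; last exact: finite_subrings.
by split; [exact: HF | exact: Fm].
Qed.

End Finiteness.

(** * Lattices given by diagonal moduli and an off-diagonal matrix *)

Section TwistedLattice.

Variables (n : nat) (o : 'I_n) (X : {set 'I_n}) (m : 'I_n -> nat).
Variable A : 'I_n -> 'I_n -> int.
Hypothesis m_gt0 : forall i, (0 < m i)%N.
Hypothesis mo : m o = 1%N.
Hypothesis A_row : forall i j, i \notin X -> A i j = 0.
Hypothesis A_col : forall i j, j \in X -> A i j = 0.
(** For closure under products: [A_scale] absorbs the terms z_j z'_j, and [A_sqr] the product of two
    off-diagonal sums. *)
Hypothesis A_scale : forall i j, (m i %| A i j * m j)%Z.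
Hypothesis A_sqr : forall i j k, (m i %| A i j * A i k)%Z.

Implicit Types v w : {ffun 'I_n -> int}.

(* m is the diagonal of moduli and A the off-diagonal part (p^k times the matrix
   of the header); the integer division is meaningful only on the lattice, and
   matters only for columns outside X. *)
Definition twist v i : int :=
  v i - v o - \sum_j A i j * ((v j - v o) %/ m j)%Z.

Definition twisted_lattice : set {ffun 'I_n -> int} :=
  [set v | forall i, (m i %| twist v i)%Z].

Let mz_neq0 i : (m i)%:Z != 0.
Proof. by rewrite -lt0n m_gt0. Qed.

Lemma twist_free v i : i \notin X -> twist v i = v i - v o.
Proof.
by move=> iX; rewrite /twist big1 ?subr0 // => j _; rewrite A_row ?mul0r.
Qed.

(** Integer division is additive once one summand is divisible; the columns where this may fail lie
    in [X], where [A] vanishes. *)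
Lemma twistD v w i :
  (forall j, j \notin X -> (m j %| v j - v o)%Z) ->
  twist (v + w) i = twist v i + twist w i.
Proof.
move=> dv; rewrite /twist.
suff -> : \sum_j A i j * (((v + w) j - (v + w) o) %/ m j)%Z =
    \sum_j A i j * ((v j - v o) %/ m j)%Z +
    \sum_j A i j * ((w j - w o) %/ m j)%Z by rewrite !ffunE; ring.
rewrite -big_split; apply: eq_bigr => j _ /=; rewrite -mulrDr !ffunE.
have [jX|jX] := boolP (j \in X); first by rewrite A_col ?mul0r.
rewrite -divzDl ?dv //; congr (_ * (_ %/ _)%Z); ring.
Qed.

Lemma twisted_lattice_free v j :
  twisted_lattice v -> j \notin X -> (m j %| v j - v o)%Z.
Proof. by move=> /(_ j) Lv jX; rewrite -twist_free. Qed.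

(** Although [twist] is not additive, [twistD] applies to w = (w - v) + v, so its residues are a
    complete invariant of the coset. *)
Lemma twist_modP v w :
  (forall i, twist v i = twist w i %[mod m i])%Z <-> twisted_lattice (w - v).
Proof.
split=> [tvw i|Lvw i].
  have dvd_free j : j \notin X -> (m j %| (w - v) j - (w - v) o)%Z.
    move=> jX; have /eqP := tvw j; rewrite eq_sym eqz_mod_dvd !twist_free // !ffunE.
    by congr (_ %| _)%Z; ring.
  have := twistD v i dvd_free; rewrite subrK => tw.
  by have /eqP := tvw i; rewrite eq_sym eqz_mod_dvd tw addrK.
apply/esym/eqP; rewrite eqz_mod_dvd -{1}[w](subrK v) twistD ?addrK //.
by move=> j; exact: twisted_lattice_free.
Qed.

Lemma twisted_lattice_subring : is_subring twisted_lattice.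
Proof.
split; first 2 last.
- move=> v w /set_mem Lv /set_mem Lw; apply/mem_set => i.
  pose q (u : {ffun 'I_n -> int}) j := ((u j - u o) %/ m j)%Z.
  have qE u j : twisted_lattice u -> j \notin X -> u j - u o = q u j * m j.
    by move=> Lu jX; rewrite divzK ?twisted_lattice_free.
  have [iX|iX] := boolP (i \in X); last first.
    rewrite twist_free // !ffunE.
    have -> : v i * w i - v o * w o =
        v i * (w i - w o) + (v i - v o) * w o by ring.
    apply: rpredD; [apply: dvdz_mull | apply: dvdz_mulr];
      exact: twisted_lattice_free.
  pose S (u : {ffun 'I_n -> int}) := \sum_j A i j * q u j.
  have uE (u : {ffun 'I_n -> int}) : u i - u o = twist u i + S u by rewrite subrK.
  have q_vw j : A i j * q (v * w) j =
      A i j * (v o * q w j + w o * q v j + q v j * m j * q w j).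
    have [jX|jX] := boolP (j \in X); first by rewrite A_col ?mul0r.
    congr (_ * _); rewrite {1}/q !ffunE.
    have -> : v j * w j - v o * w o = v o * (w j - w o) + w o * (v j - v o)
       + (v j - v o) * (w j - w o) by ring.
    rewrite !qE //.
    have -> : forall a b c d e : int, a * (b * c) + d * (e * c) + e * c * (b * c)
       = (a * b + d * e + e * c * b) * c by move=> *; ring.
    exact: mulzK.
  (* The off-diagonal sum obeys the Leibniz rule up to a correction, divisible by [m i] thanks to
     [A_scale]. *)
  have S_vw : S (v * w) = v o * S w + w o * S v
      + \sum_j A i j * m j * (q v j * q w j).
    rewrite !mulr_sumr -!big_split; apply: eq_bigr => j _ /=.
    by rewrite q_vw; ring.
  have SS : (m i %| S v * S w)%Z.
    rewrite mulr_suml rpred_sum // => j _; rewrite mulr_sumr rpred_sum // => k _.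
    have -> : A i j * q v j * (A i k * q w k) =
       A i j * A i k * (q v j * q w k) by ring.
    by rewrite dvdz_mulr.
  have SM : (m i %| \sum_j A i j * m j * (q v j * q w j))%Z.
    by rewrite rpred_sum // => j _; rewrite dvdz_mulr.
  (* Substituting v_i = v_o + [twist v i] + [S v], and likewise for w, cancels the terms
     [v o * S w + w o * S v]. *)
  have -> : twist (v * w) i = twist w i * (v o + S v)
      + twist v i * (w o + twist w i + S w)
      + (S v * S w - \sum_j A i j * m j * (q v j * q w j)).
    rewrite {1}/twist -/(S (v * w)) S_vw !ffunE.
    rewrite -[v i](subrK (v o)) -[w i](subrK (w o)) !uE; ring.
  by rewrite rpredD ?rpredB // rpredD // dvdz_mulr // ?Lv ?Lw.
- apply/mem_set => i; rewrite /twist !ffunE subrr big1 ?subr0 ?dvdz0 // => j _.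
  by rewrite !ffunE subrr div0z mulr0.
move=> v w /set_mem Lv /set_mem Lw; apply/mem_set/twist_modP => i.
by rewrite (dvdz_mod0P (Lv i)) (dvdz_mod0P (Lw i)).
Qed.

(** The residues of [twist v i] modulo [m i] classify the cosets, and every tuple of residues
    occurs. *)
Lemma twisted_lattice_index : has_index twisted_lattice (\prod_i m i).
Proof.
pose F v : {dffun forall i, 'I_(m i).-1.+1} :=
  [ffun i => inord `|(twist v i %% m i)%Z|%N].
have FE v i : (F v i)%:Z = (twist v i %% m i)%Z.
  rewrite ffunE inordK ?gez0_abs ?modz_ge0 //.
  by rewrite prednK // -ltz_nat gez0_abs ?modz_ge0 // ltz_pmod // ltz_nat.
have -> : (\prod_i m i)%N = #|{dffun forall i, 'I_(m i).-1.+1}|.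
  rewrite card_dep_ffun /image_mem -big_enum /=.
  rewrite unlock /=; elim: (enum _) => //= i s ->.
  by rewrite card_ord prednK.
apply: (has_index_fibers (F := F)) => [v w|r].
  rewrite -twist_modP; split=> [Fvw i|tvw]; first by rewrite -!FE Fvw.
  by apply/ffunP => i; apply/val_inj/eqP; rewrite -eqz_nat !FE tvw.
have r_lt i : (r i < m i)%N by rewrite -[X in (_ < X)%N]prednK.
(* A reduced tuple represents itself: [m o] = 1 forces [r o] = 0, and then all quotients by [m j]
   vanish. *)
exists [ffun i => (r i)%:Z]; apply/ffunP => i; apply/val_inj/eqP.
have ro : r o = 0%N :> nat.
  by have := r_lt o; rewrite [X in (_ < X)%N]mo ltnS leqn0 => /eqP.
rewrite -eqz_nat FE /twist !ffunE ro !subr0 big1 ?subr0 => [|j _].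
  by rewrite modz_small // ltz_nat r_lt.
by rewrite ffunE subr0 divz_small ?mulr0 // ltz_nat r_lt.
Qed.

End TwistedLattice.

(** Testing a generator of one lattice for membership in the other compares the j-th columns of the
    two matrices. *)
Lemma twisted_lattice_inj n (o : 'I_n) (X : {set 'I_n}) (m : 'I_n -> nat)
    (A B : 'I_n -> 'I_n -> int) i j :
  (forall i, (0 < m i)%N) -> o \notin X ->
  (forall i j, j \in X -> A i j = 0) -> (forall i j, j \in X -> B i j = 0) ->
  (forall i j, i \notin X -> A i j = 0) ->
  twisted_lattice o m A = twisted_lattice o m B ->
  i \in X -> j \notin X -> j != o -> (m i %| A i j - B i j)%Z.
Proof.
move=> m0 oX A_col B_col A_row LAB iX jX jo.
(* the j-th column of the generating matrix m + A *)
pose v : {ffun 'I_n -> int} := [ffun k => A k j + (k == j)%:R * m j].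
have vo : v o = 0 by rewrite ffunE A_row // eq_sym (negPf jo) mul0r.
have vj : v j = m j by rewrite ffunE A_row // eqxx mul1r add0r.
have sumv C : (forall i j, j \in X -> C i j = 0) ->
    forall k, twist o m C v k = v k - C k j.
  move=> C_col k; rewrite /twist vo subr0 (bigD1 j) //= !subr0 big1 ?addr0.
    by rewrite vj divzz eqz_nat -lt0n m0 mulr1.
  move=> l lj; have [lX|lX] := boolP (l \in X); first by rewrite C_col ?mul0r.
  by rewrite [v l]ffunE A_row // (negPf lj) mul0r addr0 subr0 div0z mulr0.
have : twisted_lattice o m A v.
  move=> k; rewrite sumv // ffunE addrAC subrr add0r.
  by case: eqP => [->|_]; rewrite ?mul1r ?mul0r ?dvdz0.
rewrite LAB => /(_ i); rewrite sumv // ffunE.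
have -> : (i == j) = false by apply: contraNF jX => /eqP <-.
by rewrite mul0r addr0.
Qed.

Local Close Scope ring_scope.

(** * Prime-power moduli and the count of matrices *)

Lemma num_subrings_matrix_ge (n p d k e : nat) :
  0 < n -> prime p -> d < n.-1 -> k * (n.-1 + d) <= e ->
  p ^ (k * (d * (n.-1 - d))) <= num_subrings n (p ^ e).
Proof.
move=> n_gt0 p_pr ltdn le_e; have p_gt0 := prime_gt0 p_pr.
pose o := Ordinal n_gt0.
have /card_geqP[s [s_uniq s_size s_sub]] : d <= #|[set~ o]%SET|.
  by rewrite cardsC1 card_ord ltnW.
pose X : {set 'I_n} := [set i in s]%SET.
have cardX : #|X| = d by rewrite cardsE (card_uniqP s_uniq).
have oX : o \notin X.
  by rewrite inE; apply/negP => /s_sub; rewrite !inE eqxx.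
pose Y := (~: (o |: X))%SET.
have cardY : #|Y| = n.-1 - d.
  have := cardsC (o |: X)%SET; rewrite cardsU1 oX cardX card_ord -/Y; lia.
have [y yY] : exists y, y \in Y by apply/card_gt0P; rewrite cardY subn_gt0.
have YP j : (j \in Y) = (j != o) && (j \notin X) by rewrite !inE negb_or.
pose r := e - k * (n.-1 + d).
(* The coordinate [y] also takes the remainder [r], so the exponents add up to 2kd + k(n-1-d) + r =
   e. *)
pose b i := if i == o then 0 else if i \in X then k + k else
  k + (if i == y then r else 0).
pose m i := p ^ b i.
have m_gt0 i : 0 < m i by rewrite expn_gt0 p_gt0.
have mo : m o = 1 by rewrite /m /b eqxx.
have mX i : i \in X -> m i = p ^ k * p ^ k.
  move=> iX; rewrite /m /b iX -expnD ifN //.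
  by apply: contraNneq oX => <-.
have sum_b : \sum_i b i = e.
  rewrite (bigID (mem X)) /= (eq_bigr (fun=> k + k)); last first.
    move=> i iX; rewrite /b iX ifN //; by apply: contraNneq oX => <-.
  rewrite sum_nat_const cardX (bigD1 o) //= {1}/b eqxx add0n.
  rewrite (eq_big (mem Y) (fun i => k + (if i == y then r else 0))).
  - rewrite big_split /= sum_nat_const cardY -big_mkcondr (big_pred1 y).
      by rewrite /r; nia.
    by move=> i /=; case: eqP => [->|]; rewrite ?andbT ?andbF.
  - by move=> i; exact: etrans (andbC _ _) (esym (YP i)).
  - by move=> i /andP[iX io]; rewrite /b (negPf iX) (negPf io).
pose q1 := (p ^ k).-1.
have qE : p ^ k = q1.+1 by rewrite prednK // expn_gt0 p_gt0.
(* Matrices are functions on all index pairs, zero off X x Y; with entries below p^k there are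
   (p^k)^(d(n-1-d)) of them. *)
pose D := [pred ij : 'I_n * 'I_n | ij \in finset.setX X Y].
pose A (a : {ffun 'I_n * 'I_n -> 'I_q1.+1}) i j : int :=
  Posz (p ^ k * a (i, j)).
have aP (a : {ffun 'I_n * 'I_n -> 'I_q1.+1}) i j :
    a \in pffun_on ord0 D predT -> ~~ ((i \in X) && (j \in Y)) -> A a i j = 0%R.
  move=> /pffun_onP[/supportP aD _] ijD; rewrite /A aD ?muln0 //.
  by rewrite !inE in ijD *.
have A_row a i j : a \in pffun_on ord0 D predT -> i \notin X -> A a i j = 0%R.
  by move=> aD iX; rewrite aP // (negPf iX).
have A_col a i j : a \in pffun_on ord0 D predT -> j \in X -> A a i j = 0%R.
  by move=> aD jX; rewrite aP // YP jX !andbF.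
have A_scale a i j :
    a \in pffun_on ord0 D predT -> (m i %| (A a i j * m j)%R)%Z.
  move=> aD; have [/andP[iX jY]|ij] := boolP ((i \in X) && (j \in Y)); last first.
    by rewrite aP // mul0r dvdz0.
  rewrite (mX i iX) /A -PoszM dvdzE /= -mulnA dvdn_pmul2l ?expn_gt0 ?p_gt0 //.
  move: jY; rewrite YP => /andP[jo jX].
  by rewrite dvdn_mull // /m /b (negPf jo) (negPf jX) dvdn_exp2l ?leq_addr.
have A_sqr a i j l :
    a \in pffun_on ord0 D predT -> (m i %| (A a i j * A a i l)%R)%Z.
  move=> aD; have [iX|iX] := boolP (i \in X); last first.
    by rewrite A_row // mul0r dvdz0.
  by rewrite (mX i iX) /A -PoszM dvdzE /= dvdn_mul // dvdn_mulr.
have -> : p ^ (k * (d * (n.-1 - d))) = #|pffun_on (ord0 : 'I_q1.+1) D predT|.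
  by rewrite card_pffun_on card_ord cardsX cardX cardY expnM qE.
apply: (num_subrings_ge (F := fun a => twisted_lattice o m (A a))).
- move=> a aD.
  exact: (twisted_lattice_subring o m_gt0
    (fun i j => A_row a i j aD) (fun i j => A_col a i j aD)
    (fun i j => A_scale a i j aD) (fun i j l => A_sqr a i j l aD)).
- move=> a aD; rewrite -sum_b expn_sum.
  exact: (twisted_lattice_index m_gt0 mo
    (fun i j => A_row a i j aD) (fun i j => A_col a i j aD)).
- move=> a a' aD a'D eqL; apply/ffunP => -[i j].
  have [/andP[iX jY]|ij] := boolP ((i \in X) && (j \in Y)); last first.
    have [/supportP a0 _] := pffun_onP aD.
    have [/supportP a'0 _] := pffun_onP a'D.
    have ijD : (i, j) \notin D by move: ij; rewrite !inE.
    by rewrite a0 ?a'0.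
  move: jY; rewrite YP => /andP[jo jX].
  have := twisted_lattice_inj m_gt0 oX
    (fun i j => A_col a i j aD) (fun i j => A_col a' i j a'D)
    (fun i j => A_row a i j aD) eqL iX jX jo.
  (* Cancelling p^k from the modulus p^(2k) leaves a congruence modulo p^k between entries below
     p^k. *)
  rewrite (mX i iX) /A !PoszM -mulrBr dvdz_mul2l ?eqz_nat -?lt0n ?expn_gt0 ?p_gt0 //.
  rewrite -eqz_mod_dvd !modz_nat eqz_nat !modn_small ?qE //.
  by move=> /eqP/val_inj.
Qed.

Theorem theorem1p9 (n e p : nat) (hn : 1 < n) (he : n.-1 <= e)
  (hp : prime p) : p ^ bexp n e <= num_subrings n (p ^ e).
Proof.
have n_gt0 := ltnW hn.
have I_gt0 : 0 < #|'I_n| by rewrite card_ord.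
rewrite /bexp; have [d ->] := bigop.eq_bigmax
  (fun d : 'I_n => e %/ (n.-1 + d) * (d * (n.-1 - d))) I_gt0.
have [ltdn|ledn] := ltnP d n.-1.
  (* Here [d] attains the maximum and k is the quotient [e %/ (n.-1 + d)]. *)
  by apply: num_subrings_matrix_ge => //; exact: leq_trunc_div.
(* Y would be empty: the exponent is 0, and d = 0 provides one subring *)
have -> : n.-1 - d = 0 by apply/eqP; rewrite subn_eq0.
have := @num_subrings_matrix_ge n p 0 0 e n_gt0 hp.
by rewrite !muln0 mul0n; apply=> //; rewrite -subn1 subn_gt0.
Qed.
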